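(* The randomized $L_1$-approximation of monotone functions is not weakly tractable. More precisely, writing $n(\varepsilon,d):=n^{\mathrm{ran}}(\varepsilon,F_{\mathrm{mon}}^d)$, there exist constants $\sigma_0,\nu,\varepsilon_0>0$ and $d_0\in\mathbb{N}$ such that, with $\varepsilon_d:=\varepsilon_0\sqrt{d_0/d}$, the quantity $n(\varepsilon_d,d)$ grows exponentially in $d$, namely $n(\varepsilon_d,d)>\nu\exp(\sigma_0 d/\sqrt{d_0})$ for all $d\ge d_0$, and hence $$\limsup_{\varepsilon^{-1}+d\to\infty}\frac{\log n(\varepsilon,d)}{\varepsilon^{-1}+d}\;\ge\;\frac{\sigma_0}{\sqrt{d_0}}\;>\;0.$$
   Context: For $\mathbf{x},\tilde{\mathbf{x}}\in\mathbb{R}^d$ write $\mathbf{x}\le\tilde{\mathbf{x}}$ iff $x_j\le\tilde x_j$ for all $j=1,\dots,d$. Let $F_{\mathrm{mon}}^d=\{f:[0,1]^d\to[-1,1]\mid \mathbf{x}\le\tilde{\mathbf{x}}\Rightarrow f(\mathbf{x})\le f(\tilde{\mathbf{x}})\}$. The task is to approximate $f\in F_{\mathrm{mon}}^d$ in $L_1([0,1]^d)$ (Lebesgue measure) from function values. A deterministic algorithm using $n\in\mathbb{N}_0$ function values is a map $A_n=\phi\circ N:F_{\mathrm{mon}}^d\to L_1([0,1]^d)$ with $N(f)=(f(\mathbf{x}_1),\dots,f(\mathbf{x}_n))\in\mathbb{R}^n$, where the nodes may be chosen adaptively ($\mathbf{x}_i$ may depend on $f(\mathbf{x}_1),\dots,f(\mathbf{x}_{i-1})$),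 and $\phi:\mathbb{R}^n\to L_1([0,1]^d)$ is any map. A Monte Carlo method $A_n=(A_n^{\omega})_{\omega\in\Omega}$ is a family of such maps indexed by a random element $\omega$ of a probability space $(\Omega,\Sigma,\mathbb{P})$, with sufficient measurability for the error $$e((A_n^\omega),F_{\mathrm{mon}}^d)=\sup_{f\in F_{\mathrm{mon}}^d}\mathbb{E}\,\|A_n^{\omega}(f)-f\|_{L_1}$$ to be well defined (and Fubini's theorem to be applicable). The Monte Carlo complexity is $$n^{\mathrm{ran}}(\varepsilon,F_{\mathrm{mon}}^d)=\inf\{n\in\mathbb{N}_0\mid \exists (A_n^\omega): e((A_n^\omega),F_{\mathrm{mon}}^d)\le\varepsilon\}.$$ The problem is called weakly tractable (in the randomized setting) if $\limsup_{\varepsilon^{-1}+d\to\infty}\frac{\log n(\varepsilon,d)}{\varepsilon^{-1}+d}=0$, where $\varepsilon\in(0,1)$ and $d\in\mathbb{N}$. *)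

(* Defs.v *)
From HB Require Import structures.
From mathcomp Require Import all_boot all_order all_algebra.
From mathcomp Require Import all_classical all_reals all_analysis.
From mathcomp Require Import measurable_realfun.

Set Implicit Arguments.
Unset Strict Implicit.
Unset Printing Implicit Defensive.
Import Order.TTheory GRing.Theory Num.Theory.
Import numFieldNormedType.Exports.

Local Open Scope classical_set_scope.
Local Open Scope ring_scope.

Section PowerMeasure.
Context d (T : measurableType d) (R : realType).
Variable mu : {sigma_finite_measure set T -> \bar R}.

Definition tuple_consp n (p : T * n.-tuple T) : n.+1.-tuple T :=
  [tuple of p.1 :: p.2].

Lemma measurable_tuple_consp n : measurable_fun setT (@tuple_consp n).
Proof.
by apply: measurable_cons; [exact: measurable_fst|exact: measurable_snd].
Qed.

Section step.
Variables (n : nat) (m : {sigma_finite_measure set (n.-tuple T) -> \bar R}).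

Definition power_measureS : set (n.+1.-tuple T) -> \bar R :=
  pushforward (mu \x m)%E (@tuple_consp n).

Let power_measureS0 : power_measureS set0 = 0%E.
Proof. by apply: measure0; exact: measurable_tuple_consp. Qed.

Let power_measureS_ge0 A : (0 <= power_measureS A)%E.
Proof. by apply: measure_ge0; exact: measurable_tuple_consp. Qed.

Let power_measureS_sigma_additive : semi_sigma_additive power_measureS.
Proof.
by apply: measure_semi_sigma_additive; exact: measurable_tuple_consp.
Qed.

HB.instance Definition _ := isMeasure.Build _ _ _ power_measureS
  power_measureS0 power_measureS_ge0 power_measureS_sigma_additive.

Lemma power_measureS_sigma_finite : sigma_finite setT power_measureS.
Proof.
have /sigma_finiteP[F [FT ndF Foo]] := sigma_finiteT mu.
have /sigma_finiteP[G [GT ndG Goo]] := sigma_finiteT m.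
pose g (t : n.+1.-tuple T) : T * n.-tuple T := (thead t, [tuple of behead t]).
have mg : measurable_fun setT g.
  by apply/measurable_fun_pair; [exact: measurable_tnth|exact: measurable_behead].
have gK : cancel (@tuple_consp n) g.
  by case=> x t; rewrite /g /tuple_consp theadE; congr pair; exact/val_inj.
exists (fun k => g @^-1` (F k `*` G k)) => [|k].
  apply/seteqP; split=> // t _.
  have [i _ Fi] : (\bigcup_i F i) (g t).1 by rewrite -FT.
  have [j _ Gj] : (\bigcup_i G i) (g t).2 by rewrite -GT.
  exists (maxn i j) => //; split.
  - by move: Fi; exact/subsetPset/ndF/leq_maxl.
  - by move: Gj; exact/subsetPset/ndG/leq_maxr.
have [mF Fk] := Foo k; have [mG Gk] := Goo k; split.
  by rewrite -[X in measurable X]setTI; apply: mg => //; exact: measurableX.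
rewrite /power_measureS /pushforward (_ : _ @^-1` _ = F k `*` G k).
  by rewrite product_measure1E// lte_mul_pinfty// ge0_fin_numE.
by rewrite -comp_preimage (_ : g \o _ = id)//; exact/funext.
Qed.

HB.instance Definition _ := Measure_isSigmaFinite.Build _ _ _ power_measureS
  power_measureS_sigma_finite.
End step.

(* n-fold product measure; it is pinned down by [power_measure_box] *)
Fixpoint power_measure n : {sigma_finite_measure set (n.-tuple T) -> \bar R} :=
  match n with
  | 0 => (\d_([tuple] : 0.-tuple T) : {finite_measure set _ -> \bar R})
  | n'.+1 => power_measureS (power_measure n')
  end.

Lemma power_measure_box n (A : 'I_n -> set T) :
  (forall i, measurable (A i)) ->
  power_measure n [set t | forall i, A i (tnth t i)] =
  (\prod_(i < n) mu (A i))%E.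
Proof.
elim: n A => [|n IH] A mA.
  by rewrite big_ord0 /= diracE mem_set//= => -[].
rewrite big_ord_recl -IH//.
rewrite /= /power_measureS /pushforward -product_measure1E//; last first.
  rewrite (_ : mkset _ =
      \bigcap_(i in setT) ((@tnth _ _ ^~ i) @^-1` A (lift ord0 i))).
    apply: fin_bigcap_measurable => // i _.
    by rewrite -[X in measurable X]setTI; exact: measurable_tnth.
  by apply/seteqP; split=> t /= h i => [_|]; exact: h.
congr (_ _); apply/seteqP; split=> -[x t] /=.
  move=> h; split; first by have := h ord0; rewrite tnth0.
  by move=> i; have := h (lift ord0 i); rewrite tnthS.
move=> [hx ht] i; case: (unliftP ord0 i) => [j|] ->; last by rewrite tnth0.
by rewrite tnthS.
Qed.
End PowerMeasure.

Section MonotoneApproximation.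
Variable R : realType.

(* points are typed over [measurableTypeR R], a copy of [R] carrying the Borel
   sigma-algebra *)
Definition vec (d : nat) : Type := d.-tuple (measurableTypeR R).

Definition coord d (x : vec d) (j : 'I_d) : R := tnth x j.

Definition vle d (x y : vec d) : Prop := forall j, coord x j <= coord y j.

Definition cube d : set (vec d) := [set x | forall j, 0 <= coord x j <= 1].

(* Lebesgue measure on all Lebesgue-measurable sets: for d >= 2 a monotone
   function need not be Borel, so the product measure has to be completed *)
Definition lebesgue_vec d : {measure set (caratheodory_type
    (power_measure (@lebesgue_measure R) d)^*%mu) -> \bar R} :=
  @completed_measure_extension _ _ _ (power_measure (@lebesgue_measure R) d).

(* functions on the cube are total functions on R^d of which only the values on
   the cube are ever used *)
Definition Fmon d : set (vec d -> R) :=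
  [set f | (forall x, cube x -> -1 <= f x <= 1) /\
           (forall x y, cube x -> cube y -> vle x y -> f x <= f y)].

(* elements of L_1([0,1]^d) are given by representatives *)
Definition L1 d : set (vec d -> R) :=
  [set g | (lebesgue_vec d).-integrable (@cube d) (EFin \o g)].

Definition L1dist d (g f : vec d -> R) : \bar R :=
  (\int[lebesgue_vec d]_(x in @cube d) (`|g x - f x|%:E))%E.

(* [node y] is the point queried after the values [y] have been observed; only
   histories of length less than n matter *)
Record det_alg (d n : nat) := DetAlg {
  node : forall i, i.-tuple R -> vec d ;
  node_cube : forall i (y : i.-tuple R), cube (node y) ;
  recon : n.-tuple R -> vec d -> R ;
  recon_L1 : forall y, L1 (recon y) }.

Fixpoint info d (nd : forall i, i.-tuple R -> vec d) (f : vec d -> R) (n : nat) :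
    n.-tuple R :=
  if n is n'.+1
  then let y := info nd f n' in [tuple of rcons y (f (nd n' y))]
  else [tuple].

Definition run d n (A : det_alg d n) (f : vec d -> R) : vec d -> R :=
  recon A (info (node A) f n).

(* The measurability needed for the expected errors to be defined. It suffices
   for exchanging the expectation with averages over finitely many inputs, and
   any stronger requirement would only increase the complexity. *)
Definition mc_measurable d n dO (O : measurableType dO)
    (A : O -> det_alg d n) : Prop :=
  forall f, Fmon f -> measurable_fun setT (fun w => L1dist (run (A w) f) f).

Definition mc_error d n dO (O : measurableType dO) (P : probability O R)
    (A : O -> det_alg d n) : \bar R :=
  ereal_sup [set (\int[P]_w L1dist (run (A w) f) f)%E | f in @Fmon d].

(* an extended real, equal to +oo if no number of function values suffices *)
Definition nran (eps : R) (d : nat) : \bar R :=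
  ereal_inf [set n%:R%:E | n in [set n : nat |
    exists (dO : measure_display) (O : measurableType dO) (P : probability O R)
      (A : O -> det_alg d n),
      mc_measurable A /\ (mc_error P A <= eps%:E)%E]].

Definition tract_filter : set (set (R * nat)) :=
  filter_from setT (fun M : R =>
    [set p | [/\ 0 < p.1 < 1, (0 < p.2)%N & M <= p.1^-1 + p.2%:R]]).

Definition tract_limsup (n : R -> nat -> \bar R) : \bar R :=
  limf_esup (fun p : R * nat => lne (n p.1 p.2) * ((p.1^-1 + p.2%:R)^-1)%:E)%E
    tract_filter.

Definition weakly_tractable (n : R -> nat -> \bar R) : Prop :=
  tract_limsup n = 0%E.

End MonotoneApproximation.

(* Main.v *)
(* Identify [0,1]^d, cut at 1/2 in every coordinate, with 2^d cells labelled by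
   subsets of 'I_d. A function equal to -1 on the cells below the middle layer,
   to 1 on those above it, and to an arbitrary sign on each of the
   'C(d, d./2) middle cells is monotone. Flipping the sign on a middle cell in
   which a deterministic algorithm queries no point leaves its output unchanged,
   and the errors on that cell for the two signs add up to at least 2 * 2^-d.
   Averaging over all signs, every method with n function values has error at
   least ('C(d, d./2) - n) / 2^d, which exceeds 1 / (8 sqrt d) as long as
   n < 'C(d, d./2) / 2, a number exponential in d. Hence d0 = 1 is admissible. *)
Require Import Defs.
From HB Require Import structures.
From mathcomp Require Import all_boot all_order all_algebra.
From mathcomp Require Import all_classical all_reals all_analysis.
From mathcomp Require Import measurable_realfun.
From mathcomp Require Import zify lra.
Import Order.TTheory GRing.Theory Num.Theory.
Import numFieldNormedType.Exports.
Local Open Scope classical_set_scope.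
Local Open Scope ring_scope.

(** * Lower bounds for central binomial coefficients *)

Lemma bin_even_step m :
  (m.+1 * 'C(m.+1.*2, m.+1) = 2 * m.*2.+1 * 'C(m.*2, m))%N.
Proof.
have e1 := mul_bin_diag m.*2.+2 m.
have e2 := mul_bin_down m.*2.+1 m.
rewrite /= in e1 e2; rewrite doubleS.
move: e1 e2.
have -> : (m.*2.+1 - m = m.+1)%N by lia.
move: 'C(m.*2.+2, m.+1) 'C(m.*2.+1, m) 'C(m.*2, m) => x y z e1 e2.
nia.
Qed.

Lemma bin_odd_step m : (2 * 'C(m.*2.+1, m) = 'C(m.+1.*2, m.+1))%N.
Proof.
have := mul_bin_diag m.*2.+2 m; rewrite doubleS /=.
move: 'C(m.*2.+2, m.+1) 'C(m.*2.+1, m) => x y; nia.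
Qed.

(** Squaring keeps the bound 4^m / (2 sqrt m) inside the integers. By [bin_even_step] the induction
    step comes down to 4k(k+1) <= (2k+1)^2. *)
Lemma central_bin_even_ge m :
  (0 < m)%N -> (16 ^ m <= 4 * m * 'C(m.*2, m) ^ 2)%N.
Proof.
elim: m => // -[|m] IH _; first by [].
have := IH isT; have := bin_even_step m.+1.
move: (m.+1) => k; rewrite (expnS 16).
move: 'C(k.+1.*2, k.+1) 'C(k.*2, k) (16 ^ k)%N => x y z E H.
rewrite -(leq_pmul2l (ltn0Sn k)).
have -> : (k.+1 * (4 * k.+1 * x ^ 2) = 4 * (k.+1 * x) ^ 2)%N by nia.
rewrite E.
have -> : (4 * (2 * k.*2.+1 * y) ^ 2 = 16 * (k.*2.+1 ^ 2 * y ^ 2))%N by nia.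
rewrite mulnCA leq_pmul2l //.
apply: (leq_trans (leq_mul (leqnn k.+1) H)).
rewrite !mulnA leq_mul2r; apply/orP; right; nia.
Qed.

Lemma central_bin_ge d : (0 < d)%N -> (4 ^ d <= 4 * d * 'C(d, d./2) ^ 2)%N.
Proof.
rewrite -{1 2 3 4}[d](odd_double_half d); move: (d./2) => m.
case: (odd d) => /= [_|]; rewrite ?add1n ?add0n.
  (* For d = 2m+1 the coefficient is half the central one of 2m+2, so the even case applies at
     m+1. *)
  have := central_bin_even_ge _ (ltn0Sn m).
  rewrite -bin_odd_step (expnS 16) (expnS 4) -mul2n expnM (_ : (4 ^ 2 = 16)%N) //.
  rewrite expnMn; move: ('C(_, _) ^ 2)%N (16 ^ m)%N => x y; nia.
rewrite double_gt0 => /central_bin_even_ge.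
rewrite -mul2n expnM (_ : (4 ^ 2 = 16)%N) //.
move: ('C(_, _) ^ 2)%N (16 ^ m)%N => x y; nia.
Qed.

(** * Integrals over finite partitions *)

Section IntegralPieces.
Context {d} {T : measurableType d} {R : realType}.
Variable mu : {measure set T -> \bar R}.

Lemma measurable_fun_bigsetU {d2} {U : measurableType d2}
    (I : Type) (r : seq I) (F : I -> set T) (f : T -> U) :
  (forall i, measurable (F i)) -> (forall i, measurable_fun (F i) f) ->
  measurable_fun (\big[setU/set0]_(i <- r) F i) f.
Proof.
move=> mF mf; elim: r => [|i r IH]; first by rewrite big_nil; exact: measurable_fun_set0.
rewrite big_cons; apply/measurable_funU => //.
exact: bigsetU_measurable.
Qed.

Lemma ge0_integral_fin_partition (I : finType) (F : I -> set T) (f : T -> \bar R) :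
  (forall i, measurable (F i)) -> trivIset setT F ->
  (forall i, measurable_fun (F i) f) -> (forall x, (0 <= f x)%E) ->
  (\int[mu]_(x in \big[setU/set0]_i F i) f x = \sum_i \int[mu]_(x in F i) f x)%E.
Proof.
move=> mF tF mf f0; rewrite ge0_integral_bigsetU //.
- exact: index_enum_uniq.
- exact: sub_trivIset tF.
- exact: measurable_fun_bigsetU.
Qed.

Lemma ge0_integralD_ge (D : set T) (f g : T -> R) (a : R) :
  measurable D -> measurable_fun D f -> measurable_fun D g ->
  (forall x, 0 <= f x) -> (forall x, 0 <= g x) -> 0 <= a ->
  (forall x, D x -> a <= f x + g x) ->
  (a%:E * mu D <= \int[mu]_(x in D) (f x)%:E + \int[mu]_(x in D) (g x)%:E)%E.
Proof.
move=> mD mf mg f0 g0 a0 afg.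
have Mf : measurable_fun D (EFin \o f) by exact/measurable_EFinP.
have Mg : measurable_fun D (EFin \o g) by exact/measurable_EFinP.
rewrite -ge0_integralD //; try by move=> x _; rewrite lee_fin.
rewrite -integral_cst //; apply: ge0_le_integral => //.
- exact: emeasurable_funD.
Qed.

End IntegralPieces.

(** * Cells of the cube and sign functions on the middle layer *)

Section Cells.
Context {R : realType} {d : nat}.
Implicit Types (x : vec R d) (c : {set 'I_d}) (s : {set {set 'I_d}}).

(** Giving the point 1/2 to the upper half only makes the cells a genuine partition of the cube,
    with no overlaps of measure zero to discard. *)
Definition cell_side c (j : 'I_d) : set (measurableTypeR R) :=
  [set` if j \in c then `[2^-1 : R, 1] else `[0 : R, 2^-1[].

Definition cell c : set (vec R d) :=
  [set x | forall j, cell_side c j (tnth x j)].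

Definition profile x : {set 'I_d} := [set j | 2^-1 <= (tnth x j : R)]%SET.

Lemma profile_cell c x : cell c x -> profile x = c.
Proof.
move=> cx; apply/setP => j; rewrite inE; have := cx j.
rewrite /cell_side; case: ifP => _ /=; rewrite in_itv /=; first by case/andP.
by case/andP=> _ ?; apply/negbTE; rewrite -ltNge.
Qed.

Lemma cell_profile x : cube x -> cell (profile x) x.
Proof.
move=> cx j; rewrite /cell_side inE; have := cx j; rewrite /Defs.coord.
by case: ifP => [h|/negbT]; rewrite -?ltNge /= in_itv /= => *; lra.
Qed.

Lemma cell_cube c : cell c `<=` @cube R d.
Proof.
move=> x cx j; have := cx j; rewrite /cell_side /Defs.coord.
by case: ifP => _ /=; rewrite in_itv /= => *; lra.
Qed.

Lemma cube_cells :
  @cube R d = \big[setU/set0]_(c <- index_enum {set 'I_d}) cell c.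
Proof.
apply/seteqP; split=> x; rewrite -bigcup_seq.
  by move=> cx; exists (profile x); [rewrite /= mem_index_enum|exact: cell_profile].
by case=> c _; exact: cell_cube.
Qed.

Lemma trivIset_cell (D : set {set 'I_d}) : trivIset D cell.
Proof. by move=> c c' _ _ [x [/profile_cell <- /profile_cell <-]]. Qed.

Lemma measurable_cell_side c j : measurable (cell_side c j).
Proof. by rewrite /cell_side; case: ifP => _; exact: measurable_itv. Qed.

Lemma measurable_cell c : measurable (cell c).
Proof.
rewrite (_ : cell c = \bigcap_(j in setT) ((@tnth _ _ ^~ j) @^-1` cell_side c j)).
  apply: fin_bigcap_measurable => // j _.
  rewrite -[X in measurable X]setTI; apply: measurable_tnth => //.
  exact: measurable_cell_side.
by apply/seteqP; split=> t /= h j => [_|]; exact: h.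
Qed.

Local Notation carT := (caratheodory_type (power_measure (@lebesgue_measure R) d)^*%mu).

Lemma measurable_cell_vec c : measurable (cell c : set carT).
Proof.
apply: sub_caratheodory; apply: sub_sigma_algebra; exact: measurable_cell.
Qed.

Lemma lebesgue_cell c : lebesgue_vec R d (cell c) = (2^-1 ^+ d)%:E.
Proof.
rewrite /lebesgue_vec /= /completed_measure_extension measurable_mu_extE; last first.
  exact: measurable_cell.
transitivity (\prod_(j < d) lebesgue_measure (cell_side c j))%E.
  by apply: power_measure_box => j; exact: measurable_cell_side.
rewrite (eq_bigr (fun=> (2^-1)%:E)).
  by rewrite prodEFin prodr_const card_ord.
move=> j _; rewrite /cell_side.
by case: ifP => _; rewrite lebesgue_measure_itv /= lte_fin -EFinD ifT;
  try congr (_%:E); lra.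
Qed.

(* [s] collects the middle cells with value 1; its members off the middle layer
   play no role, so that the signs may range over a whole power set. *)
Definition layer_fun (s : {set {set 'I_d}}) x : R :=
  let c := profile x in
  if (#|c| < d./2)%N then -1 else if (d./2 < #|c|)%N then 1 else
  if c \in s then 1 else -1.

(** Profiles grow with the point, so the layer index cannot drop. Nested profiles of equal size
    coincide, hence signs of different middle cells are never compared. *)
Lemma layer_fun_Fmon s : Fmon (layer_fun s).
Proof.
split=> [x _|x y _ _ xy]; rewrite /layer_fun /=.
  by repeat case: ifP => _; lra.
have sub : (profile x \subset profile y).
  by apply/fintype.subsetP => j; rewrite !inE => /le_trans; apply; exact: xy.
have le := subset_leq_card sub.
case: (ltngtP #|profile x| d./2) => hx; case: (ltngtP #|profile y| d./2) => hy;
  try lia; try (repeat case: ifP => _; lra).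
have /eqP -> : profile x == profile y by rewrite eqEcard sub hx hy leqnn.
by [].
Qed.

Definition flip c s : {set {set 'I_d}} :=
  (if c \in s then s :\ c else c |: s)%SET.

Lemma mem_flip c s : (c \in flip c s) = (c \notin s).
Proof. by rewrite /flip; case: ifP => cs; rewrite !inE eqxx. Qed.

Lemma mem_flip_neq c c' s : c' != c -> (c' \in flip c s) = (c' \in s).
Proof. by move=> h; rewrite /flip; case: ifP => cs; rewrite !inE (negbTE h). Qed.

Lemma flipK c : involutive (flip c).
Proof.
move=> s; apply/setP => c'; have [->|h] := eqVneq c' c.
  by rewrite !mem_flip negbK.
by rewrite !mem_flip_neq.
Qed.

Lemma layer_fun_flip c s x :
  profile x != c -> layer_fun (flip c s) x = layer_fun s x.
Proof. by move=> h; rewrite /layer_fun mem_flip_neq. Qed.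

Lemma layer_fun_cell c s x : #|c| = d./2 -> cell c x ->
  layer_fun s x = if c \in s then 1 else -1.
Proof. by move=> hc /profile_cell h; rewrite /layer_fun h hc ltnn. Qed.

Lemma measurable_layer_fun s c : measurable_fun (cell c : set carT) (layer_fun s).
Proof.
pose v : R := if (#|c| < d./2)%N then -1 else if (d./2 < #|c|)%N then 1 else
  if c \in s then 1 else -1.
have : measurable_fun (cell c : set carT) (cst v) by exact: measurable_cst.
apply: eq_measurable_fun => x.
by rewrite inE => /profile_cell h; rewrite /layer_fun h.
Qed.

Definition cell_dist c (g f : vec R d -> R) : \bar R :=
  (\int[lebesgue_vec R d]_(x in cell c) (`|g x - f x|%:E))%E.

Lemma measurable_dist_cell g s c : L1 g ->
  measurable_fun (cell c : set carT) (fun x => `|g x - layer_fun s x|).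
Proof.
move=> /measurable_int mg.
apply: (measurableT_comp (@normr_measurable R setT)).
apply: measurable_funB; last exact: measurable_layer_fun.
apply: (@measurable_funS _ _ _ _ (@cube R d : set carT)).
- rewrite cube_cells; apply: bigsetU_measurable => ? _; exact: measurable_cell_vec.
- exact: cell_cube.
- exact/measurable_EFinP.
Qed.

Lemma L1dist_cells g s : L1 g ->
  L1dist g (layer_fun s) = (\sum_c cell_dist c g (layer_fun s))%E.
Proof.
move=> Lg; rewrite /L1dist cube_cells; apply: ge0_integral_fin_partition.
- exact: measurable_cell_vec.
- exact: (@trivIset_cell setT).
- by move=> c; apply/measurable_EFinP; exact: measurable_dist_cell.
- by move=> x; rewrite lee_fin.
Qed.

(** On the cell the two functions are the constants 1 and -1, and |g - 1| + |g + 1| >= 2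
    pointwise. *)
Lemma cell_dist_flip g c s : L1 g -> #|c| = d./2 ->
  ((2 * 2^-1 ^+ d)%:E <=
   cell_dist c g (layer_fun s) + cell_dist c g (layer_fun (flip c s)))%E.
Proof.
move=> Lg hc; rewrite EFinM -(lebesgue_cell c).
apply: ge0_integralD_ge.
- exact: measurable_cell_vec.
- exact: measurable_dist_cell.
- exact: measurable_dist_cell.
- by move=> x; exact: normr_ge0.
- by move=> x; exact: normr_ge0.
- by [].
move=> x cx; rewrite !(layer_fun_cell _ _ _ hc cx) mem_flip.
have := ler_normB (g x - 1) (g x + 1).
have -> : (g x - 1 - (g x + 1)) = - 2 by lra.
rewrite normrN (@ger0_norm _ 2) //.
by case: (c \in s) => /=; rewrite !opprK //; lra.
Qed.

End Cells.

(** * Averaging a deterministic algorithm over all sign patterns *)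

Lemma sum_involution_ge (R : realType) (S : finType) (P : pred S) (h : S -> S)
    (D : S -> \bar R) (v : R) :
  involutive h -> (forall s, P (h s) = P s) -> (forall s, (0 <= D s)%E) ->
  (forall s, P s -> ((2 * v)%:E <= D s + D (h s))%E) ->
  ((#|P|%:R * v)%:E <= \sum_(s | P s) D s)%E.
Proof.
move=> hK hP D0 HD.
(* Since [h] permutes the index set, twice the sum groups each [s] with [h s]. *)
have E : (\sum_(s | P s) D s = \sum_(s | P s) D (h s))%E.
  by rewrite (reindex_inj (inv_inj hK)); exact: eq_bigl.
have : (\sum_(s | P s) (2 * v)%:E <= \sum_(s | P s) D s + \sum_(s | P s) D s)%E.
  by rewrite {2}E -big_split; exact: lee_sum.
rewrite sumEFin sumr_const -mulr_natl.
have := sume_ge0 (fun s (_ : P s) => D0 s).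
(* Halving is legitimate only for a finite sum; for +oo the bound is trivial. *)
case: (\sum_(s | P s) D s)%E => [r||] //; last by rewrite !leey.
by rewrite -EFinD !lee_fin => _ ?; lra.
Qed.

Section Adversary.
Context {R : realType} {d n : nat}.

(** Adaptivity does no harm: equal answers so far give equal histories, hence the same next node for
    both functions. *)
Lemma info_eq (nd : forall i, i.-tuple R -> vec R d) (f f' : vec R d -> R) k :
  (forall i, (i < k)%N -> f (nd i (info nd f i)) = f' (nd i (info nd f i))) ->
  info nd f k = info nd f' k.
Proof.
elim: k => //= k IH H; have e := IH (fun i ik => H i (leqW ik)).
by rewrite -e H.
Qed.

Variable A : det_alg R d n.

Definition queried (s : {set {set 'I_d}}) : {set {set 'I_d}} :=
  [set profile (node A (info (node A) (layer_fun s) i)) | i : 'I_n]%SET.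

Lemma card_queried s : (#|queried s| <= n)%N.
Proof. by rewrite (leq_trans (leq_imset_card _ _)) // cardT size_enum_ord. Qed.

Lemma info_flip c s k : c \notin queried s -> (k <= n)%N ->
  info (node A) (layer_fun (flip c s)) k = info (node A) (layer_fun s) k.
Proof.
move=> cs kn; apply/esym/info_eq => i ik.
rewrite layer_fun_flip //; apply: contraNneq cs => <-.
by apply/imsetP; exists (Ordinal (leq_trans ik kn)).
Qed.

Lemma queried_flip c s : c \notin queried s -> queried (flip c s) = queried s.
Proof.
by move=> cs; apply: eq_imset => i /=; rewrite info_flip // ltnW.
Qed.

(** The patterns that leave [c] unqueried are closed under the flip and so fall into pairs; one
    direction is the other applied to the flipped pattern. *)
Lemma notin_queried_flip c s :
  (c \notin queried (flip c s)) = (c \notin queried s).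
Proof.
apply/idP/idP => h; last by rewrite queried_flip.
by rewrite -[s](flipK c) queried_flip.
Qed.

Lemma run_flip c s : c \notin queried s ->
  run A (layer_fun (flip c s)) = run A (layer_fun s).
Proof. by move=> cs; rewrite /run info_flip. Qed.

Lemma run_L1 f : L1 (run A f).
Proof. exact: recon_L1. Qed.

Local Notation layer := [set c : {set 'I_d} | #|c| == d./2]%SET.

(** Double counting of pairs of a pattern and an unqueried middle cell. Truncated subtraction keeps
    the bound valid for large [n]. *)
Lemma unqueried_count :
  (#|{set {set 'I_d}}| * ('C(d, d./2) - n) <=
   \sum_(c in layer) #|[pred s | c \notin queried s]|)%N.
Proof.
under eq_bigr do rewrite -sum1_card.
rewrite (exchange_big_dep predT) //= -sum_nat_const; apply: leq_sum => s _.
rewrite (_ : (\sum_(_ in _ | _) 1)%N = #|layer :\: queried s|); last first.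
  by rewrite -sum1_card; apply: eq_bigl => c; rewrite !inE andbC.
rewrite cardsD card_draws card_ord leq_sub2l //.
by rewrite (leq_trans (subset_leq_card (subsetIr _ _))) // card_queried.
Qed.

Lemma cell_dist_ge0 (c : {set 'I_d}) (g f : vec R d -> R) : (0 <= cell_dist c g f)%E.
Proof. by apply: integral_ge0 => x _; rewrite lee_fin. Qed.

(** Only the middle cells are kept, and for each of them only the patterns that leave it unqueried.
    Flipped partners among these share one output, so [cell_dist_flip] bounds their joint error. *)
Lemma sum_L1dist_ge :
  (((#|{set {set 'I_d}}| * ('C(d, d./2) - n))%:R * 2^-1 ^+ d)%:E <=
   \sum_s L1dist (run A (layer_fun s)) (layer_fun s))%E.
Proof.
apply: (@le_trans _ _ (\sum_s \sum_(c in layer)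
    cell_dist c (run A (layer_fun s)) (layer_fun s))%E); last first.
  apply: lee_sum => s _; rewrite (L1dist_cells _ _ (run_L1 _)).
  rewrite [leRHS](bigID (mem layer)) leeDl // sume_ge0 // => c _.
  exact: cell_dist_ge0.
rewrite exchange_big /=.
apply: (@le_trans _ _ (\sum_(c in layer)
    (#|[pred s | c \notin queried s]|%:R * 2^-1 ^+ d)%:E)%E).
  rewrite sumEFin lee_fin -mulr_suml ler_wpM2r ?exprn_ge0 // -natr_sum ler_nat.
  exact: unqueried_count.
apply: lee_sum => c; rewrite inE => /eqP hc.
rewrite [leRHS](bigID (fun s => c \notin queried s)) /=.
apply: (@le_trans _ _ (\sum_(s | c \notin queried s)
    cell_dist c (run A (layer_fun s)) (layer_fun s))%E); last first.
  by rewrite leeDl // sume_ge0 // => s _; exact: cell_dist_ge0.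
apply: (@sum_involution_ge _ _ _ (flip c)) => [|s|s|s hs].
- exact: flipK.
- exact: notin_queried_flip.
- exact: cell_dist_ge0.
- rewrite run_flip //; apply: cell_dist_flip => //; exact: run_L1.
Qed.

End Adversary.

(** * From deterministic algorithms to Monte Carlo methods *)

Lemma sum_expectation_ge {R : realType} dO (O : measurableType dO)
    (P : probability O R) (I : finType) (F : I -> O -> \bar R) (a : R) :
  (forall i, measurable_fun setT (F i)) -> (forall i w, (0 <= F i w)%E) ->
  0 <= a -> (forall w, (a%:E <= \sum_i F i w)%E) ->
  (a%:E <= \sum_i \int[P]_w F i w)%E.
Proof.
move=> mF F0 a0 aF; rewrite -ge0_integral_sum // -[leLHS]mule1.
rewrite -(@probability_setT _ _ _ P) -integral_cst //.
apply: ge0_le_integral => //; exact: emeasurable_sum.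
Qed.

Section MonteCarlo.
Context {R : realType}.

(** The worst-case error dominates the average over all patterns, and the deterministic bound, valid
    for each random outcome, survives taking expectations. *)
Lemma mc_error_ge d n dO (O : measurableType dO) (P : probability O R)
    (A : O -> det_alg R d n) (eps : R) :
  mc_measurable A -> (mc_error P A <= eps%:E)%E ->
  ('C(d, d./2) - n)%:R * 2^-1 ^+ d <= eps.
Proof.
move=> mA eA; set N := #|{set {set 'I_d}}|.
have N0 : (0 < N)%N by apply/card_gt0P; exists finset.set0.
have : (((N * ('C(d, d./2) - n))%:R * 2^-1 ^+ d)%:E <= (N%:R * eps)%:E)%E.
  apply: (@le_trans _ _ (\sum_(s : {set {set 'I_d}})
     \int[P]_w L1dist (run (A w) (layer_fun s)) (layer_fun s))%E).
    apply: sum_expectation_ge => [s|s w| |w].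
    - by apply: mA; exact: layer_fun_Fmon.
    - by apply: integral_ge0 => x _; rewrite lee_fin.
    - by rewrite mulr_ge0 ?exprn_ge0.
    - exact: sum_L1dist_ge.
  rewrite mulr_natl -sumr_const -sumEFin; apply: lee_sum => s _.
  apply: le_trans eA; apply: ereal_sup_ubound.
  by exists (layer_fun s) => //; exact: layer_fun_Fmon.
by rewrite lee_fin natrM -mulrA ler_pM2l // ltr0n.
Qed.

Lemma nran_ge (eps : R) d :
  eps * 2 ^+ d < 'C(d, d./2)%:R / 2 ->
  (('C(d, d./2)%:R / 2)%:E <= nran eps d)%E.
Proof.
move=> H; apply: le_ereal_inf_tmp => _ [n [dO [ O [P [A [mA eA]]]]] <-].
have := mc_error_ge _ _ _ _ _ _ _ mA eA.
rewrite exprVn ler_pdivrMr ?exprn_gt0 // => /le_lt_trans/(_ H) => h.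
(* The case split undoes the truncated subtraction. *)
rewrite lee_fin; case: (leqP n 'C(d, d./2)) => [nC|].
  by move: h; rewrite natrB // => ?; lra.
by rewrite -(ltr_nat R) => ?; have := ler0n R 'C(d, d./2); lra.
Qed.

End MonteCarlo.

(** * Exponential growth in the dimension and the upper limit *)

Section Numeric.
Context {R : realType}.

Lemma expR_ln2_sqr (d : nat) : expR (ln 2 / 2 * d%:R) ^+ 2 = 2 ^+ d :> R.
Proof.
rewrite -expRM_natr (_ : ln 2 / 2 * d%:R * 2 = ln 2 * d%:R :> R); last by lra.
by rewrite expRM_natr lnK // posrE.
Qed.

Lemma central_bin_sqrt_ge (d : nat) : (0 < d)%N ->
  2 ^+ d <= 2 * Num.sqrt d%:R * 'C(d, d./2)%:R :> R.
Proof.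
move=> d0; rewrite -(@ler_pXn2r _ 2) ?nnegrE ?mulr_ge0 ?sqrtr_ge0 ?exprn_ge0 //.
rewrite !exprMn sqr_sqrtr // -exprM mulnC exprM.
have -> : 2 ^+ 2 = 4%:R :> R by rewrite expr2; lra.
by rewrite -!natrX -!natrM ler_nat central_bin_ge.
Qed.

Lemma nran_exp_ge (d : nat) : (0 < d)%N ->
  ((4^-1 * expR (ln 2 / 2 * d%:R))%:E <= nran (8^-1 * Num.sqrt (1 / d%:R) : R) d)%E.
Proof.
move=> d0; have C2 := central_bin_sqrt_ge _ d0.
have E2 := expR_ln2_sqr d.
have e0 : 0 < expR (ln 2 / 2 * d%:R) :> R := expR_gt0 _.
have t0 : 0 < Num.sqrt d%:R :> R by rewrite sqrtr_gt0 ltr0n.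
have te : Num.sqrt d%:R <= expR (ln 2 / 2 * d%:R) :> R.
  rewrite -(@ler_pXn2r _ 2) ?nnegrE ?sqrtr_ge0 ?ltW // sqr_sqrtr // E2.
  by rewrite -natrX ltr_nat ltn_expl.
have C0 : 0 < 'C(d, d./2)%:R :> R by rewrite ltr0n bin_gt0; lia.
rewrite div1r sqrtrV //.
apply: (@le_trans _ _ ('C(d, d./2)%:R / 2)%:E); last first.
  (* From 2^d <= 2 sqrt d C, the choice eps = 1 / (8 sqrt d) gives eps 2^d <= C / 4. *)
  apply: nran_ge; apply: (@le_lt_trans _ _ ('C(d, d./2)%:R / 4)); last by lra.
  by rewrite mulrAC ler_pdivrMr //; lra.
rewrite lee_fin; move: C2; rewrite -E2.
move: (expR _) (Num.sqrt _) 'C(_, _)%:R e0 t0 te C0 => e t C e0 t0 te C0 h.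
(* Here e = 2^(d/2) and t = sqrt d <= e, so e^2 <= 2tC yields e <= 2C. *)
have : e * e <= 2 * e * C by rewrite -expr2 (le_trans h) // ler_wpM2r ?(ltW C0) //; lra.
by rewrite -mulrA mulrCA ler_pM2l // => ?; lra.
Qed.

(** Every tail of the filter contains one of these points, where the quotient is at least [s]; hence
    every tail supremum is too. *)
Lemma tract_limsup_ge (n : R -> nat -> \bar R) (s : R) :
  (forall M, exists p : R * nat, [/\ 0 < p.1 < 1, (0 < p.2)%N, M <= p.1^-1 + p.2%:R &
    ((expR (s * (p.1^-1 + p.2%:R)))%:E <= n p.1 p.2)%E]) ->
  (s%:E <= tract_limsup n)%E.
Proof.
move=> H; rewrite /tract_limsup limf_esupE; apply: le_ereal_inf_tmp => _ [V [M _ MV] <-].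
have [p [p1 p2 pM np]] := H M.
apply: le_ereal_sup_tmp; exists (lne (n p.1 p.2) * ((p.1^-1 + p.2%:R)^-1)%:E)%E.
  by exists p => //; exact: MV.
have P0 : 0 < p.1^-1 + p.2%:R :> R by rewrite addr_gt0 ?ltr0n // invr_gt0; case/andP: p1.
rewrite -[X in (X%:E <= _)%E](mulfK (lt0r_neq0 P0)) EFinM.
apply: lee_wpmul2r; first by rewrite lee_fin invr_ge0 ltW.
have <- : (lne (expR (s * (p.1^-1 + p.2%:R)))%:E = (s * (p.1^-1 + p.2%:R))%:E)%E.
  by rewrite lne_EFin ?expR_gt0 // expRK.
rewrite lee_lne // in_itv /= leey andbT ?lee_fin ?expR_ge0 //.
by rewrite (le_trans _ np) // lee_fin expR_ge0.
Qed.

Lemma tract_limsup_nran : ((ln 2 / 4)%:E <= tract_limsup (@nran R))%E.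
Proof.
have l2 : 0 < ln 2 :> R by rewrite ln_gt0 // ltr1n.
apply: tract_limsup_ge => M.
(* With t = sqrt d, the target exponent (ln 2 / 4)(8t + t^2) must not exceed ln 2 (t^2 / 2 - 2),
   that is t^2 / 4 - 2 - 2t >= 0. This holds for t >= 10, hence the 100. *)
set d := maxn 100 (Num.bound `|M|).
have d100 : 100 <= d%:R :> R by rewrite ler_nat leq_maxl.
have dM : M <= d%:R.
  rewrite (le_trans (ler_norm _)) // ltW // (lt_le_trans (archi_boundP _)) //.
  by rewrite ler_nat leq_maxr.
have d0 : (0 < d)%N by rewrite leq_max.
have t10 : 10 <= Num.sqrt d%:R :> R.
  by rewrite -(@ler_pXn2r _ 2) ?nnegrE ?sqrtr_ge0 // sqr_sqrtr // expr2; lra.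
have tt : Num.sqrt d%:R ^+ 2 = d%:R :> R by rewrite sqr_sqrtr.
exists (8^-1 * Num.sqrt (1 / d%:R), d) => /=.
have := nran_exp_ge _ d0; rewrite div1r sqrtrV // invfM !invrK.
set t := Num.sqrt d%:R in t10 tt *.
have t0 : 0 < t by lra.
move=> H; split=> //.
- by rewrite mulr_gt0 ?invr_gt0 //= -invfM invf_lt1; lra.
- lra.
apply: le_trans H; rewrite lee_fin.
rewrite [X in _ <= X * _](_ : 4^-1 = expR (ln 2 * - 2)); last first.
  rewrite mulrN expRN -[2 in X in expR X]/(2%:R) expRM_natr lnK ?posrE //.
  by congr (_^-1); lra.
rewrite -expRD ler_expR -tt.
suff : 0 <= ln 2 * (t ^+ 2 / 4 - 2 - 2 * t) by lra.
by rewrite mulr_ge0 ?ltW //; nra.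
Qed.

End Numeric.

Theorem mainTheorem3 (R : realType) :
  ~ weakly_tractable (@nran R) /\
  exists (sigma0 nu eps0 : R) (d0 : nat),
    [/\ [/\ 0 < sigma0, 0 < nu, 0 < eps0 & (0 < d0)%N],
        forall d : nat, (d0 <= d)%N ->
          ((nu * expR (sigma0 * d%:R / Num.sqrt d0%:R))%:E
             < nran (eps0 * Num.sqrt (d0%:R / d%:R)) d)%E,
        ((sigma0 / Num.sqrt d0%:R)%:E <= tract_limsup (@nran R))%E
      & 0 < sigma0 / Num.sqrt d0%:R].
Proof.
have l2 : 0 < ln 2 / 4 :> R by rewrite divr_gt0 // ln_gt0 // ltr1n.
split.
  move=> wt; have := tract_limsup_nran (R := R).
  by rewrite wt lee_fin leNgt l2.
(* The rate is halved from ln 2 / 2 because the limsup bound must absorb 1/eps = 8 sqrt d; nu = 1/8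
   instead of 1/4 makes the inequality strict. *)
exists (ln 2 / 4), 8^-1, 8^-1, 1%N; rewrite sqrtr1 divr1.
split=> //; last exact: tract_limsup_nran.
move=> d d0; rewrite divr1; apply: lt_le_trans (nran_exp_ge _ d0).
rewrite lte_fin; apply: (@lt_le_trans _ _ (4^-1 * expR (ln 2 / 4 * d%:R))).
  by rewrite ltr_pM2r ?expR_gt0 //; lra.
by rewrite ler_pM2l // ler_expR ler_wpM2r //; lra.
Qed.
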